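(* Let $\mathcal{X}$ be a Banach space, $V$ a finite dimensional subspace of $\mathcal{X}$, $\varepsilon>0$, and let $M:\mathcal{X}\to\mathbb{R}^m$ be a measurement operator with null space $\mathcal{N}\neq\{0\}$ such that $\mathcal{N}\cap V=\{0\}$. Then for the approximation set $\mathcal{K}=\mathcal{K}(\varepsilon,V)$ the following hold. (i) For any $w\in\mathbb{R}^m$ such that $w=M(v)$ with $v\in V$, we have $\operatorname{rad}(\mathcal{K}_w)=\varepsilon\,\mu(\mathcal{N},V)$. (ii) For any $w\in\mathbb{R}^m$, we have $\operatorname{rad}(\mathcal{K}_w)\le 2\varepsilon\,\mu(\mathcal{N},V)$. (iii) $\varepsilon\,\mu(\mathcal{N},V)\le R(\mathcal{K})\le 2\varepsilon\,\mu(\mathcal{N},V)$.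
   Context: All Banach spaces are real. A measurement operator is a map $M:\mathcal{X}\to\mathbb{R}^m$, $M(f)=(l_1(f),\dots,l_m(f))$, where $l_1,\dots,l_m\in\mathcal{X}^*$ are linearly independent; its null space is $\mathcal{N}=\{f\in\mathcal{X}: M(f)=0\}$. The approximation set is $\mathcal{K}(\varepsilon,V)=\{f\in\mathcal{X}:\operatorname{dist}(f,V)_{\mathcal{X}}\le\varepsilon\}$. For $S\subset\mathcal{X}$ and $w\in\mathbb{R}^m$, $S_w:=\{f\in S: M(f)=w\}$. The Chebyshev radius is $\operatorname{rad}(S):=\inf_{a\in\mathcal{X}}\sup_{f\in S}\|f-a\|$ (with $\operatorname{rad}(\emptyset)=0$), and $R(S):=\sup_{w\in\mathbb{R}^m}\operatorname{rad}(S_w)$. For subspaces $X\ne\{0\}$ and $Y$ of $\mathcal{X}$, $\mu(X,Y):=\sup_{x\in X\setminus\{0\}}\frac{\|x\|}{\operatorname{dist}(x,Y)}=\sup_{x\in X\setminus\{0\},\,y\in Y}\frac{\|x\|}{\|x-y\|}\in[1,\infty]$. *)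

(* Defs.v *)
From mathcomp Require Import all_boot all_order all_algebra.
From mathcomp Require Import all_classical all_reals all_analysis.

Set Implicit Arguments.
Unset Strict Implicit.
Unset Printing Implicit Defensive.

Import Order.TTheory GRing.Theory Num.Theory.
Import numFieldNormedType.Exports.
Local Open Scope classical_set_scope.
Local Open Scope ring_scope.
Local Open Scope ereal_scope.

(* A span of finitely many vectors, not required to be independent; n = 0 gives
   the zero subspace. *)
Definition finite_dim_subspace (R : realType) (X : normedModType R)
    (V : set X) : Prop :=
  exists (n : nat) (e : 'I_n -> X),
    V = range (fun c : 'I_n -> R => (\sum_(i < n) c i *: e i)%R).

(* [R^o] is [R] seen as a normed module over itself, so each [l i] is a
   continuous linear functional. *)
Definition measurement_operator (R : realType) (X : normedModType R) (m : nat)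
    (M : X -> 'rV[R]_m) : Prop :=
  exists l : 'I_m -> {linear X -> R^o},
    [/\ forall i, continuous (l i),
        forall c : 'I_m -> R,
          (forall f : X, (\sum_(i < m) c i *: l i f)%R = 0%R) ->
          forall i, c i = 0%R
      & forall f : X, M f = (\row_(i < m) l i f)%R].

Definition null_space (R : realType) (X : normedModType R) (m : nat)
    (M : X -> 'rV[R]_m) : set X := [set f | M f = 0%R].

Definition dist_set (R : realType) (X : normedModType R) (f : X) (Y : set X)
    : \bar R := ereal_inf [set (`|f - y|%R)%:E | y in Y].

Definition approximation_set (R : realType) (X : normedModType R) (eps : R)
    (V : set X) : set X := [set f | dist_set f V <= eps%:E].

Definition slice (R : realType) (X : normedModType R) (m : nat)
    (M : X -> 'rV[R]_m) (S : set X) (w : 'rV[R]_m) : set X :=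
  [set f | S f /\ M f = w].

(* The empty set is treated apart because [ereal_sup set0 = -oo]. *)
Definition chebyshev_radius (R : realType) (X : normedModType R) (S : set X)
    : \bar R :=
  if S == set0 then 0
  else ereal_inf (range (fun a : X =>
         ereal_sup [set (`|f - a|%R)%:E | f in S])).

Definition worst_radius (R : realType) (X : normedModType R) (m : nat)
    (M : X -> 'rV[R]_m) (S : set X) : \bar R :=
  ereal_sup (range (fun w : 'rV[R]_m => chebyshev_radius (slice M S w))).

(* In [\bar R], [0^-1 = +oo]: the quotient is [+oo] when [dist_set x Y = 0], as
   required for a supremum with values in [1, +oo]. *)
Definition mu (R : realType) (X : normedModType R) (N Y : set X) : \bar R :=
  ereal_sup [set (`|x|%R)%:E / dist_set x Y | x in N `\ 0%R].

(* Main.v *)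
Require Import Defs.
From mathcomp Require Import all_boot all_order all_algebra.
From mathcomp Require Import all_classical all_reals all_analysis.

Set Implicit Arguments.
Unset Strict Implicit.
Unset Printing Implicit Defensive.

Import Order.TTheory GRing.Theory Num.Theory.
Import numFieldNormedType.Exports.
Local Open Scope classical_set_scope.
Local Open Scope ring_scope.
Local Open Scope ereal_scope.

(** The number [eps * mu N V] is the radius of the central slice, in disguise:
    by homogeneity of the norm and of the distance, it is the supremum of [`|x|]
    over the [x] in [N] with [dist_set x V <= eps].  Its two halves are
    [normr_le_mu] and [mu_le].

    If [w = M v] with [v] in [V], then translation by [v] preserves the distance
    to [V] and adds [w] to the measurements, so the slice at [w] is [v + S]
    with [S] the symmetric set of the [x] in [N] with [dist_set x V <= eps].
    The ball centred at [v] bounds its radius by [sup_S `|x|]; conversely a set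
    that contains both [v + x] and [v - x] has radius at least [`|x|], whatever
    the centre, by the triangle inequality.

    For a general [w], any point of the slice is an admissible centre: the
    difference of two points lies in [N], at distance at most [2 * eps] from
    [V], so its norm is at most [2 * eps * mu N V].  The estimates on the worst
    radius follow, the lower one from the slice at [w = 0].

    A vector [x <> 0] of [N] with [dist_set x V = 0] makes [mu N V] infinite, and
    the slice at [w = M v] then contains the whole line through [v] in the
    direction of [x], so that its radius is infinite too: the equality and both
    estimates hold in the extended reals. *)

(** * Linear subsets *)

Definition linear_subset (R : realType) (X : normedModType R) (V : set X) :=
  V 0%R /\ forall (a : R) u v, V u -> V v -> V (a *: u + v)%R.

Lemma linear_subsetD (R : realType) (X : normedModType R) (V : set X) u v :
  linear_subset V -> V u -> V v -> V (u + v)%R.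
Proof. by move=> [_ VL] Vu Vv; rewrite -[u]scale1r; exact: VL. Qed.

Lemma linear_subsetZ (R : realType) (X : normedModType R) (V : set X)
  (a : R) u : linear_subset V -> V u -> V (a *: u)%R.
Proof. by move=> [V0 VL] Vu; rewrite -[X in V X]addr0; exact: VL. Qed.

Lemma linear_subsetN (R : realType) (X : normedModType R) (V : set X) u :
  linear_subset V -> V u -> V (- u)%R.
Proof. by move=> VL Vu; rewrite -scaleN1r; exact: linear_subsetZ. Qed.

Lemma linear_subset_finite_dim (R : realType) (X : normedModType R)
  (V : set X) : finite_dim_subspace V -> linear_subset V.
Proof.
move=> [n [e ->]]; split.
  by exists (fun=> 0%R) => //; rewrite big1// => i _; rewrite scale0r.
move=> a _ _ [c _ <-] [d _ <-]; exists (fun i => (a * c i + d i)%R) => //.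
rewrite scaler_sumr -big_split/=; apply: eq_bigr => i _.
by rewrite scalerDl scalerA.
Qed.

Lemma measurement_operator_linear (R : realType) (X : normedModType R) (m : nat)
    (M : X -> 'rV[R]_m) :
  measurement_operator M ->
  forall (a : R) f g, M (a *: f + g)%R = (a *: M f + M g)%R.
Proof.
move=> [l [_ _ Ml]] a f g; apply/rowP => i.
by rewrite !Ml !mxE linearD linearZ.
Qed.

Lemma measurement_operator0 (R : realType) (X : normedModType R) (m : nat)
    (M : X -> 'rV[R]_m) : measurement_operator M -> M 0%R = 0%R.
Proof.
by move=> [l [_ _ Ml]]; apply/rowP => i; rewrite Ml !mxE linear0.
Qed.

Lemma linear_subset_null_space (R : realType) (X : normedModType R) (m : nat)
    (M : X -> 'rV[R]_m) :
  measurement_operator M -> linear_subset (null_space M).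
Proof.
move=> hM; split; first exact: measurement_operator0.
move=> a u v Mu Mv; rewrite /null_space/= measurement_operator_linear//.
by rewrite Mu Mv scaler0 addr0.
Qed.

(** * Distance to a linear subset *)

Lemma dist_set_ge0 (R : realType) (X : normedModType R) (f : X) (V : set X) :
  0 <= dist_set f V.
Proof. by apply: le_ereal_inf_tmp => _ [v _ <-]; rewrite lee_fin. Qed.

Lemma dist_set_le (R : realType) (X : normedModType R) (f v : X) (V : set X) :
  V v -> dist_set f V <= (`|f - v|%R)%:E.
Proof. by move=> Vv; apply: ereal_inf_lbound; exists v. Qed.

Lemma dist_set_fin_num (R : realType) (X : normedModType R) (f : X)
    (V : set X) : linear_subset V -> dist_set f V \is a fin_num.
Proof.
move=> [V0 _]; rewrite ge0_fin_numE ?dist_set_ge0//.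
by apply: le_lt_trans (dist_set_le f V0) _; rewrite ltry.
Qed.

Lemma dist_setZ_le (R : realType) (X : normedModType R) (a : R) (f : X)
    (V : set X) :
  linear_subset V -> a != 0%R -> dist_set (a *: f)%R V <= `|a|%:E * dist_set f V.
Proof.
move=> VL a0; rewrite -lee_pdivrMl ?normr_gt0//.
apply: le_ereal_inf_tmp => _ [v Vv <-]; rewrite lee_pdivrMl ?normr_gt0//.
rewrite -EFinM -normrZ scalerBr; apply: dist_set_le; exact: linear_subsetZ.
Qed.

Lemma dist_set_translate_le (R : realType) (X : normedModType R) (f v : X)
    (V : set X) : linear_subset V -> V v -> dist_set (v + f)%R V <= dist_set f V.
Proof.
move=> VL Vv; apply: le_ereal_inf_tmp => _ [u Vu <-].
have -> : (f - u = (v + f) - (v + u))%R by rewrite opprD addrACA subrr add0r.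
by apply: dist_set_le; exact: linear_subsetD.
Qed.

Lemma dist_setB_le (R : realType) (X : normedModType R) (f g : X)
    (V : set X) :
  linear_subset V -> dist_set (f - g)%R V <= dist_set f V + dist_set g V.
Proof.
move=> VL; rewrite -leeBlDr ?dist_set_fin_num//.
apply: le_ereal_inf_tmp => _ [u Vu <-].
rewrite leeBlDr ?dist_set_fin_num// addeC -leeBlDr//.
apply: le_ereal_inf_tmp => _ [v Vv <-]; rewrite leeBlDr// -EFinD.
have Vuv : V (u - v)%R by apply: linear_subsetD => //; exact: linear_subsetN.
apply: le_trans (dist_set_le _ Vuv) _; rewrite lee_fin.
have -> : (f - g - (u - v) = (f - u) - (g - v))%R.
  by rewrite !opprB [(v - u)%R]addrC addrACA [(- g + v)%R]addrC.
by rewrite [leRHS]addrC ler_normB.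
Qed.

(** * The quantity [mu] *)

Lemma mu_ge0 (R : realType) (X : normedModType R) (N V : set X) :
  linear_subset N -> N <> [set 0%R] -> 0 <= mu N V.
Proof.
move=> [N0 _] NN0.
have [x [Nx x0]] : N `\ 0%R !=set0.
  apply/set0P/eqP => NE; apply: NN0; apply/seteqP; split=> [x Nx|_ ->//].
  by apply: contrapT => x0; suff: (N `\ 0%R) x by rewrite NE.
apply: (@le_trans _ _ ((`|x|%R)%:E / dist_set x V)).
  by rewrite mule_ge0 ?lee_fin// inve_ge0 dist_set_ge0.
by apply: ereal_sup_ubound; exists x.
Qed.

(** The passage from the quotient of [mu] to an estimate that survives
    [dist_set x V = 0], where the quotient is [+oo]: inversion is antitone on
    all of the nonnegative extended reals. *)
Lemma normr_le_mu (R : realType) (X : normedModType R) (N V : set X) (c : R) x :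
  linear_subset N -> linear_subset V -> N <> [set 0%R] -> (0 < c)%R ->
  N x -> dist_set x V <= c%:E -> (`|x|%R)%:E <= c%:E * mu N V.
Proof.
move=> NL VL NN0 c0 Nx dc.
have [->|x0] := eqVneq x 0%R.
  by rewrite normr0 mule_ge0 ?lee_fin ?(ltW c0)// mu_ge0.
rewrite -lee_pdivrMl//; apply: (@le_trans _ _ ((`|x|%R)%:E / dist_set x V)).
  rewrite muleC lee_wpmul2l ?lee_fin//.
  have -> : (c^-1)%:E = c%:E^-1 by rewrite inver gt_eqF.
  by rewrite lee_pV2// inE ?dist_set_ge0// lee_fin ltW.
by apply: ereal_sup_ubound; exists x => //; split => //; exact/eqP.
Qed.

(** Rescaling an [x] in [N] to the level [dist_set x V = eps] gives the
    quotient in [mu]; when [dist_set x V = 0], all multiples of [x] qualify and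
    [r] is forced to be infinite. *)
Lemma mu_le (R : realType) (X : normedModType R) (N V : set X) (eps : R) r :
  linear_subset N -> linear_subset V -> (0 < eps)%R ->
  (forall x, N x -> dist_set x V <= eps%:E -> (`|x|%R)%:E <= r) ->
  eps%:E * mu N V <= r.
Proof.
move=> NL VL e0 H; rewrite -lee_pdivlMl//.
apply: ge_ereal_sup => _ [x [Nx /eqP x0] <-]; rewrite lee_pdivlMl//.
have scaled (t : R) : (0 < t)%R -> t%:E * dist_set x V <= eps%:E ->
    (t * `|x|)%R%:E <= r.
  move=> t0 td; rewrite -(gtr0_norm t0) -normrZ; apply: H.
    exact: linear_subsetZ.
  apply: le_trans td; rewrite -{2}(gtr0_norm t0); apply: dist_setZ_le => //.
  by rewrite gt_eqF.
have nx : (0 < `|x|)%R by rewrite normr_gt0.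
have := dist_set_ge0 x V; have := dist_set_fin_num x VL.
case: (dist_set x V) scaled => // d scaled _; rewrite lee_fin => d0.
have [d_eq|dN] := eqVneq d 0%R.
  suff -> : r = +oo by rewrite leey.
  apply/eqyP => A A0; have -> : A = (A / `|x| * `|x|)%R by rewrite divfK// gt_eqF.
  by apply: scaled; rewrite ?divr_gt0// d_eq mule0 lee_fin ltW.
have d_gt0 : (0 < d)%R by rewrite lt_def dN.
rewrite inver (negbTE dN) -!EFinM mulrCA mulrC.
by apply: scaled; rewrite ?divr_gt0// -EFinM divfK.
Qed.

(** * Chebyshev radius *)

Lemma chebyshev_radius_le (R : realType) (X : normedModType R) (S : set X)
    (a : X) (r : \bar R) :
  0 <= r -> (forall f, S f -> (`|f - a|%R)%:E <= r) -> chebyshev_radius S <= r.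
Proof.
move=> r0 H; rewrite /chebyshev_radius; case: ifPn => // _.
apply: (@le_trans _ _ (ereal_sup [set (`|f - a|%R)%:E | f in S])).
  by apply: ereal_inf_lbound; exists a.
by apply: ge_ereal_sup => _ [f Sf <-]; exact: H.
Qed.

(** Whatever the centre [a], one of [v + x] and [v - x] is at distance at least
    [`|x|] from it, as their difference is [2 x]. *)
Lemma normr_le_chebyshev_radius (R : realType) (X : normedModType R)
    (S : set X) (v x : X) :
  S (v + x)%R -> S (v - x)%R -> (`|x|%R)%:E <= chebyshev_radius S.
Proof.
move=> Sp Sm; rewrite /chebyshev_radius ifF; last first.
  by apply/negbTE/set0P; exists (v + x)%R.
apply: le_ereal_inf_tmp => _ [a _ <-].
have hp : (`|v + x - a|%R)%:E <= ereal_sup [set (`|f - a|%R)%:E | f in S].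
  by apply: ereal_sup_ubound; exists (v + x)%R.
have hm : (`|v - x - a|%R)%:E <= ereal_sup [set (`|f - a|%R)%:E | f in S].
  by apply: ereal_sup_ubound; exists (v - x)%R.
have : (`|x| <= Num.max `|v + x - a| `|v - x - a|)%R.
  have E : (x *+ 2 = (v + x - a) - (v - x - a))%R.
    rewrite [(v + x - a)%R]addrAC [(v - x - a)%R]addrAC opprD opprK addrACA.
    by rewrite subrr add0r mulr2n.
  have : (`|x| *+ 2 <= `|v + x - a| + `|v - x - a|)%R.
    by rewrite -normrMn E ler_normB.
  by rewrite le_max mulr2n; apply: contraTT; rewrite negb_or -!ltNge => /andP[];
    exact: ltrD.
by rewrite -lee_fin EFin_max => /le_trans; apply; rewrite ge_max hp hm.
Qed.

(** * Slices of the approximation set *)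

Lemma chebyshev_radius_slice_image (R : realType) (X : normedModType R)
    (V : set X) (eps : R) (m : nat) (M : X -> 'rV[R]_m) v :
  linear_subset V -> (0 < eps)%R -> measurement_operator M ->
  null_space M <> [set 0%R] -> V v ->
  chebyshev_radius (slice M (approximation_set eps V) (M v))
    = eps%:E * mu (null_space M) V.
Proof.
move=> VL e0 hM NN0 Vv; have NL := linear_subset_null_space hM.
apply/eqP; rewrite eq_le; apply/andP; split.
  apply: (@chebyshev_radius_le _ _ _ v).
    by rewrite mule_ge0 ?lee_fin ?(ltW e0)// mu_ge0.
  move=> f [Kf Mf]; apply: normr_le_mu => //.
    rewrite /null_space/= addrC -scaleN1r measurement_operator_linear// Mf.
    by rewrite scaleN1r addNr.
  rewrite addrC; apply: le_trans Kf; apply: dist_set_translate_le => //.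
  exact: linear_subsetN.
have in_slice x : null_space M x -> dist_set x V <= eps%:E ->
    slice M (approximation_set eps V) (M v) (v + x)%R.
  move=> Nx dx; split.
    by apply: le_trans dx; exact: dist_set_translate_le.
  by rewrite -[v]scale1r measurement_operator_linear// Nx addr0 !scale1r.
apply: mu_le => // x Nx dx; apply: (@normr_le_chebyshev_radius _ _ _ v).
  exact: in_slice.
apply: in_slice; first exact: linear_subsetN.
apply: le_trans dx; rewrite -scaleN1r.
by apply: le_trans (dist_setZ_le _ VL _) _; rewrite ?normrN1 ?mul1e// oppr_eq0 oner_eq0.
Qed.

(** The factor 2 comes from the centre: a point of the slice is itself only
    within [eps] of [V], so differences are within [2 * eps]. *)
Lemma chebyshev_radius_slice_le (R : realType) (X : normedModType R)
    (V : set X) (eps : R) (m : nat) (M : X -> 'rV[R]_m) w :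
  linear_subset V -> (0 < eps)%R -> measurement_operator M ->
  null_space M <> [set 0%R] ->
  chebyshev_radius (slice M (approximation_set eps V) w)
    <= 2%:E * eps%:E * mu (null_space M) V.
Proof.
move=> VL e0 hM NN0; have NL := linear_subset_null_space hM.
have e2 : (0 < 2 * eps)%R by rewrite mulr_gt0.
have bound0 : 0 <= 2%:E * eps%:E * mu (null_space M) V.
  by rewrite -EFinM mule_ge0 ?lee_fin ?(ltW e2)// mu_ge0.
have [K0|/set0P[g [Kg Mg]]] :=
    eqVneq (slice M (approximation_set eps V) w) set0.
  by rewrite /chebyshev_radius K0 eqxx.
apply: (@chebyshev_radius_le _ _ _ g) => // f [Kf Mf].
rewrite -EFinM; apply: normr_le_mu => //.
  rewrite /null_space/= addrC -scaleN1r measurement_operator_linear// Mf Mg.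
  by rewrite scaleN1r addNr.
apply: le_trans (dist_setB_le _ _ VL) _.
by rewrite mulr_natl mulr2n EFinD; exact: leeD.
Qed.

Theorem theorem4p5 (R : realType) (X : completeNormedModType R) (V : set X)
    (eps : R) (m : nat) (M : X -> 'rV[R]_m)
    (hV : finite_dim_subspace V)
    (heps : (0 < eps)%R)
    (hM : measurement_operator M)
    (hN : null_space M <> [set 0%R])
    (hNV : null_space M `&` V = [set 0%R]) :
  [/\ forall w : 'rV[R]_m, (exists2 v, V v & w = M v) ->
        chebyshev_radius (slice M (approximation_set eps V) w)
          = eps%:E * mu (null_space M) V,
      forall w : 'rV[R]_m,
        chebyshev_radius (slice M (approximation_set eps V) w)
          <= 2%:E * eps%:E * mu (null_space M) V
    & eps%:E * mu (null_space M) V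
          <= worst_radius M (approximation_set eps V)
          <= 2%:E * eps%:E * mu (null_space M) V].
Proof.
have VL := linear_subset_finite_dim hV.
have upper w := chebyshev_radius_slice_le w VL heps hM hN.
split=> [_ [v Vv ->]||//]; first exact: chebyshev_radius_slice_image.
  exact: upper.
apply/andP; split.
  rewrite -(chebyshev_radius_slice_image VL heps hM hN VL.1).
  by apply: ereal_sup_ubound; exists (M 0%R).
by apply: ge_ereal_sup => _ [w _ <-]; exact: upper.
Qed.
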